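(* Let $\mathcal{R}$ be a commutative cancellative semi-ring of characteristic $1$ with semi-field of fractions $\mathcal{F}$. 1. Let $\sim$ be a cancellative congruence on $\mathcal{R}$. Then one defines (independently of the choices of representatives) a congruence $\sim_{\mathcal{F}}$ on $\mathcal{F}$ by $$\forall A,B,A',B'\in\mathcal{R},\quad A-B\sim_{\mathcal{F}}A'-B'\iff A+B'\sim A'+B.$$ The class of $0$ for $\sim_{\mathcal{F}}$ is $\{A-B: A,B\in\mathcal{R},\ A\sim B\}$. Moreover, for any $A,B\in\mathcal{R}$, $A\sim B\iff A\sim_{\mathcal{F}}B$. 2. Conversely, let $\sim_1$ be a congruence on $\mathcal{F}$. Then there exists a unique cancellative congruence $\sim$ on $\mathcal{R}$ such that $\sim_{\mathcal{F}}=\sim_1$, namely the restriction of $\sim_1$ to $\mathcal{R}$. 3. For $\sim$ a cancellative congruence on $\mathcal{R}$, the natural map $\mathcal{R}/\sim\;\to\mathcal{F}/\sim_{\mathcal{F}}$ is an injective homomorphism of semi-rings and identifies $\mathcal{F}/\sim_{\mathcal{F}}$ with the semi-field of fractions of $\mathcal{R}/\sim$.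
   Context: A commutative semi-ring of characteristic $1$ is a triple $(\mathcal{R},\oplus,+)$ with two associative laws such that: $(\mathcal{R},+)$ is an abelian monoid with identity $0$; $\oplus$ is commutative with $X\oplus X=X$ for all $X$; and $X+(Y\oplus Z)=(X+Y)\oplus(X+Z)$ for all $X,Y,Z$. It is cancellative if $X+Y=X+Z$ implies $Y=Z$. A cancellative $\mathcal{R}$ embeds canonically in its semi-field of fractions $\mathcal{F}=\{X-Y: X,Y\in\mathcal{R}\}$, where $(\mathcal F,+)$ is the group of differences and $(A-B)\oplus(A'-B')=\bigl((A+B')\oplus(A'+B)\bigr)-(B+B')$. A congruence on $\mathcal{R}$ is an equivalence relation $\sim$ such that $X\sim Y$ implies $X+Z\sim Y+Z$ and $X\oplus Z\sim Y\oplus Z$ for all $Z\in\mathcal{R}$; it is cancellative if $X+Y\sim X+Z$ implies $Y\sim Z$ (and then $\mathcal{R}/\sim$ with the induced laws is cancellative). A congruence on $\mathcal{F}$ is an equivalence relation such that $X\sim Y$ implies $-X\sim-Y$, $X+Z\sim Y+Z$ and $X\oplus Z\sim Y\oplus Z$ for all $Z\in\mathcal{F}$. Quotients carry the induced laws. *)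

(* Defs.v *)
From HB Require Import structures.
From mathcomp Require Import all_boot ssralg boolp.
From Corelib Require Import RelationClasses.

Set Implicit Arguments.
Unset Strict Implicit.
Unset Printing Implicit Defensive.

Import GRing.Theory.
Local Open Scope ring_scope.
Local Open Scope quotient_scope.

Reserved Notation "x \oplus y" (at level 50, left associativity).
Reserved Notation "x %:F" (left associativity, format "x %:F").

(* The "product" of the semi-ring is the operation [+] of the [nmodType], with
   neutral element [0]; its idempotent "addition" is [oplus], for which no
   neutral element is assumed. *)
HB.mixin Record Nmodule_isSemiring1 V of GRing.Nmodule V := {
  oplus : V -> V -> V;
  oplusA : associative oplus;
  oplusC : commutative oplus;
  oplusxx : idempotent_op oplus;
  addr_oplusr : right_distributive (@GRing.add V) oplus
}.

#[short(type="semiring1Type")]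
HB.structure Definition Semiring1 :=
  {V of Nmodule_isSemiring1 V & GRing.Nmodule V}.

Bind Scope ring_scope with Semiring1.sort.

Notation "x \oplus y" := (oplus x y) : ring_scope.

HB.mixin Record Semiring1_isCancellative V of Semiring1 V := {
  cancel_addl : right_injective (@GRing.add V)
}.

#[short(type="cancelSemiring1Type")]
HB.structure Definition CancelSemiring1 :=
  {V of Semiring1_isCancellative V & Semiring1 V}.

Bind Scope ring_scope with CancelSemiring1.sort.

#[short(type="semifield1Type")]
HB.structure Definition Semifield1 := {V of Semiring1 V & GRing.Zmodule V}.

Bind Scope ring_scope with Semifield1.sort.

Definition semiring1_morphism (R S : semiring1Type) (f : R -> S) : Prop :=
  [/\ f 0 = 0, {morph f : x y / x + y} & {morph f : x y / x \oplus y}].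

Record congruence (R : semiring1Type) (sim : R -> R -> Prop) : Prop := {
  cong_equiv : Equivalence sim;
  cong_add : forall X Y Z, sim X Y -> sim (X + Z) (Y + Z);
  cong_oplus : forall X Y Z, sim X Y -> sim (X \oplus Z) (Y \oplus Z)
}.

Record cancel_congruence (R : semiring1Type) (sim : R -> R -> Prop) : Prop := {
  cancel_cong :> congruence sim;
  cancel_congP : forall X Y Z, sim (X + Y) (X + Z) -> sim Y Z
}.

Record semifield_congruence (F : semifield1Type) (sim : F -> F -> Prop) :
    Prop := {
  semifield_cong :> congruence sim;
  semifield_cong_opp : forall X Y, sim X Y -> sim (- X) (- Y)
}.

(* [generic_quotient] wants a boolean relation, whence [asbool]. The congruence
   proof is an argument of this relation so that the canonical structures below
   can be inferred from the quotient type. *)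
Definition cong_rel (R : semiring1Type) (sim : R -> R -> Prop)
  (h : congruence sim) : rel R := fun x y => `[< sim x y >].

Lemma cong_rel_refl (R : semiring1Type) (sim : R -> R -> Prop)
  (h : congruence sim) : reflexive (cong_rel h).
Proof. by have [[hr _ _] _ _] := h => x; apply/asboolP; apply: hr. Qed.

Lemma cong_rel_sym (R : semiring1Type) (sim : R -> R -> Prop)
  (h : congruence sim) : symmetric (cong_rel h).
Proof.
have [[_ hs _] _ _] := h => x y.
by apply/asboolP/asboolP; apply: hs.
Qed.

Lemma cong_rel_trans (R : semiring1Type) (sim : R -> R -> Prop)
  (h : congruence sim) : transitive (cong_rel h).
Proof.
have [[_ _ ht] _ _] := h => y x z /asboolP xy /asboolP yz.
by apply/asboolP; apply: ht xy yz.
Qed.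

Canonical cong_rel_equiv (R : semiring1Type) (sim : R -> R -> Prop)
    (h : congruence sim) :=
  EquivRel (cong_rel h) (@cong_rel_refl _ _ h) (@cong_rel_sym _ _ h)
    (@cong_rel_trans _ _ h).

Definition quot (R : semiring1Type) (sim : R -> R -> Prop)
  (h : congruence sim) := {eq_quot (cong_rel h)}.

HB.instance Definition _ (R : semiring1Type) (sim : R -> R -> Prop)
    (h : congruence sim) : EqQuotient _ (cong_rel h) (quot h) :=
  EqQuotient.on (quot h).
HB.instance Definition _ (R : semiring1Type) (sim : R -> R -> Prop)
    (h : congruence sim) := Choice.on (quot h).

Lemma quotP (R : semiring1Type) (sim : R -> R -> Prop) (h : congruence sim)
  (x y : R) : \pi_(quot h) x = \pi_(quot h) y <-> sim x y.
Proof.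
split=> [/eqmodP/asboolP // | xy]; exact/eqmodP/asboolP.
Qed.

Lemma cong_repr (R : semiring1Type) (sim : R -> R -> Prop) (h : congruence sim)
  (x : R) : sim x (repr (\pi_(quot h) x)).
Proof. by apply/(quotP h); rewrite reprK. Qed.

Definition quot_add (R : semiring1Type) (sim : R -> R -> Prop)
  (h : congruence sim) := lift_op2 (quot h) (@GRing.add R).

Definition quot_oplus (R : semiring1Type) (sim : R -> R -> Prop)
  (h : congruence sim) := lift_op2 (quot h) (@oplus R).

Lemma pi_quot_add (R : semiring1Type) (sim : R -> R -> Prop)
    (h : congruence sim) :
  {morph \pi_(quot h) : x y / x + y >-> quot_add x y}.
Proof.
move=> x y; unlock quot_add; apply/quotP.
have [[_ _ ht] ha _] := h.
apply: (ht _ (repr (\pi_(quot h) x) + y)); first exact: ha (cong_repr h x).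
rewrite (addrC _ y) (addrC _ (repr (\pi_(quot h) y))); exact: ha (cong_repr h y).
Qed.
Canonical pi_quot_add_morph (R : semiring1Type) (sim : R -> R -> Prop)
  (h : congruence sim) := PiMorph2 (pi_quot_add h).

Lemma pi_quot_oplus (R : semiring1Type) (sim : R -> R -> Prop)
    (h : congruence sim) :
  {morph \pi_(quot h) : x y / x \oplus y >-> quot_oplus x y}.
Proof.
move=> x y; unlock quot_oplus; apply/quotP.
have [[_ _ ht] _ ho] := h.
apply: (ht _ (repr (\pi_(quot h) x) \oplus y)); first exact: ho (cong_repr h x).
rewrite (oplusC _ y) (oplusC _ (repr (\pi_(quot h) y))); exact: ho (cong_repr h y).
Qed.
Canonical pi_quot_oplus_morph (R : semiring1Type) (sim : R -> R -> Prop)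
  (h : congruence sim) := PiMorph2 (pi_quot_oplus h).

Lemma quot_addA (R : semiring1Type) (sim : R -> R -> Prop)
  (h : congruence sim) : associative (@quot_add _ _ h).
Proof.
by elim/quotW=> x; elim/quotW=> y; elim/quotW=> z; rewrite !piE addrA.
Qed.

Lemma quot_addC (R : semiring1Type) (sim : R -> R -> Prop)
  (h : congruence sim) : commutative (@quot_add _ _ h).
Proof. by elim/quotW=> x; elim/quotW=> y; rewrite !piE addrC. Qed.

Lemma quot_add0 (R : semiring1Type) (sim : R -> R -> Prop)
  (h : congruence sim) : left_id (\pi_(quot h) 0) (@quot_add _ _ h).
Proof. by elim/quotW=> x; rewrite !piE add0r. Qed.

HB.instance Definition _ (R : semiring1Type) (sim : R -> R -> Prop)
    (h : congruence sim) :=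
  GRing.isNmodule.Build (quot h) (@quot_addA _ _ h) (@quot_addC _ _ h)
    (@quot_add0 _ _ h).

Lemma quot_oplusA (R : semiring1Type) (sim : R -> R -> Prop)
  (h : congruence sim) : associative (@quot_oplus _ _ h).
Proof.
by elim/quotW=> x; elim/quotW=> y; elim/quotW=> z; rewrite !piE oplusA.
Qed.

Lemma quot_oplusC (R : semiring1Type) (sim : R -> R -> Prop)
  (h : congruence sim) : commutative (@quot_oplus _ _ h).
Proof. by elim/quotW=> x; elim/quotW=> y; rewrite !piE oplusC. Qed.

Lemma quot_oplusxx (R : semiring1Type) (sim : R -> R -> Prop)
  (h : congruence sim) : idempotent_op (@quot_oplus _ _ h).
Proof. by elim/quotW=> x; rewrite !piE oplusxx. Qed.

Lemma quot_add_oplusr (R : semiring1Type) (sim : R -> R -> Prop)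
    (h : congruence sim) :
  right_distributive (@GRing.add (quot h)) (@quot_oplus _ _ h).
Proof.
elim/quotW=> x; elim/quotW=> y; elim/quotW=> z.
by rewrite /GRing.add /= !piE addr_oplusr.
Qed.

HB.instance Definition _ (R : semiring1Type) (sim : R -> R -> Prop)
    (h : congruence sim) :=
  Nmodule_isSemiring1.Build (quot h) (@quot_oplusA _ _ h) (@quot_oplusC _ _ h)
    (@quot_oplusxx _ _ h) (@quot_add_oplusr _ _ h).

(* An alias of [quot], so that the cancellative structure can be inferred. *)
Definition cancel_quot (R : semiring1Type) (sim : R -> R -> Prop)
  (h : cancel_congruence sim) := quot (cancel_cong h).

HB.instance Definition _ (R : semiring1Type) (sim : R -> R -> Prop)
    (h : cancel_congruence sim) :
  EqQuotient _ (cong_rel (cancel_cong h)) (cancel_quot h) :=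
  EqQuotient.on (cancel_quot h).
HB.instance Definition _ (R : semiring1Type) (sim : R -> R -> Prop)
    (h : cancel_congruence sim) := Semiring1.on (cancel_quot h).

Lemma cancel_quot_addl (R : semiring1Type) (sim : R -> R -> Prop)
    (h : cancel_congruence sim) :
  right_injective (@GRing.add (cancel_quot h)).
Proof.
elim/quotW=> x; elim/quotW=> y; elim/quotW=> z.
rewrite /GRing.add /= !piE => /quotP xyz.
exact/(quotP (cancel_cong h))/(cancel_congP h xyz).
Qed.

HB.instance Definition _ (R : semiring1Type) (sim : R -> R -> Prop)
    (h : cancel_congruence sim) :=
  Semiring1_isCancellative.Build (cancel_quot h) (@cancel_quot_addl _ _ h).

(* An alias of [quot], so that the group structure can be inferred. *)
Definition semifield_quot (F : semifield1Type) (sim : F -> F -> Prop)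
  (h : semifield_congruence sim) := quot (semifield_cong h).

HB.instance Definition _ (F : semifield1Type) (sim : F -> F -> Prop)
    (h : semifield_congruence sim) :
  EqQuotient _ (cong_rel (semifield_cong h)) (semifield_quot h) :=
  EqQuotient.on (semifield_quot h).
HB.instance Definition _ (F : semifield1Type) (sim : F -> F -> Prop)
    (h : semifield_congruence sim) := Semiring1.on (semifield_quot h).

Definition semifield_quot_opp (F : semifield1Type) (sim : F -> F -> Prop)
    (h : semifield_congruence sim) :=
  lift_op1 (semifield_quot h) (@GRing.opp F).

Lemma pi_semifield_quot_opp (F : semifield1Type) (sim : F -> F -> Prop)
    (h : semifield_congruence sim) :
  {morph \pi_(semifield_quot h) : x / - x >-> semifield_quot_opp x}.
Proof.
move=> x; unlock semifield_quot_opp; apply/(quotP (semifield_cong h)).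
exact: semifield_cong_opp h _ _ (cong_repr (semifield_cong h) x).
Qed.
Canonical pi_semifield_quot_opp_morph (F : semifield1Type)
  (sim : F -> F -> Prop) (h : semifield_congruence sim) :=
  PiMorph1 (pi_semifield_quot_opp h).

Lemma semifield_quot_addN (F : semifield1Type) (sim : F -> F -> Prop)
    (h : semifield_congruence sim) :
  left_inverse (0 : semifield_quot h) (@semifield_quot_opp _ _ h) +%R.
Proof.
elim/quotW=> x; rewrite -pi_semifield_quot_opp.
by rewrite [LHS](esym (pi_quot_add _ _ _)) addNr.
Qed.

HB.instance Definition _ (F : semifield1Type) (sim : F -> F -> Prop)
    (h : semifield_congruence sim) :=
  GRing.Nmodule_isZmodule.Build (semifield_quot h) (@semifield_quot_addN _ _ h).

(* A pair [(A, B)] represents the difference [A - B]. *)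
Definition frac_rel (R : cancelSemiring1Type) : rel (R * R) :=
  fun x y => x.1 + y.2 == y.1 + x.2.

Lemma frac_rel_refl (R : cancelSemiring1Type) : reflexive (@frac_rel R).
Proof. by move=> x; rewrite /frac_rel. Qed.

Lemma frac_rel_sym (R : cancelSemiring1Type) : symmetric (@frac_rel R).
Proof. by move=> x y; rewrite /frac_rel eq_sym. Qed.

Lemma frac_rel_trans (R : cancelSemiring1Type) : transitive (@frac_rel R).
Proof.
move=> y x z /eqP xy /eqP yz; apply/eqP/(@cancel_addl R y.2).
by rewrite addrCA addrA xy addrAC yz addrAC addrC.
Qed.

Canonical frac_rel_equiv (R : cancelSemiring1Type) :=
  EquivRel (@frac_rel R) (@frac_rel_refl R) (@frac_rel_sym R)
    (@frac_rel_trans R).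

Definition frac (R : cancelSemiring1Type) := {eq_quot (@frac_rel R)}.

HB.instance Definition _ (R : cancelSemiring1Type) :
  EqQuotient _ (@frac_rel R) (frac R) := EqQuotient.on (frac R).
HB.instance Definition _ (R : cancelSemiring1Type) := Choice.on (frac R).

Lemma fracP (R : cancelSemiring1Type) (x y : R * R) :
  \pi_(frac R) x = \pi_(frac R) y <-> x.1 + y.2 = y.1 + x.2.
Proof. by split=> [/eqmodP/eqP //|xy]; apply/eqmodP/eqP. Qed.

Lemma frac_repr (R : cancelSemiring1Type) (x : R * R) :
  x.1 + (repr (\pi_(frac R) x)).2 = (repr (\pi_(frac R) x)).1 + x.2.
Proof. by apply/fracP; rewrite reprK. Qed.

Definition frac_add_pair (R : cancelSemiring1Type) (x y : R * R) : R * R :=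
  (x.1 + y.1, x.2 + y.2).

Definition frac_opp_pair (R : cancelSemiring1Type) (x : R * R) : R * R :=
  (x.2, x.1).

Definition frac_oplus_pair (R : cancelSemiring1Type) (x y : R * R) : R * R :=
  ((x.1 + y.2) \oplus (y.1 + x.2), x.2 + y.2).

Definition frac_add (R : cancelSemiring1Type) :=
  lift_op2 (frac R) (@frac_add_pair R).
Definition frac_opp (R : cancelSemiring1Type) :=
  lift_op1 (frac R) (@frac_opp_pair R).
Definition frac_oplus (R : cancelSemiring1Type) :=
  lift_op2 (frac R) (@frac_oplus_pair R).

Lemma pi_frac_add (R : cancelSemiring1Type) :
  {morph \pi_(frac R) : x y / frac_add_pair x y >-> frac_add x y}.
Proof.
move=> x y; unlock frac_add; apply/fracP => /=.
by rewrite addrACA !frac_repr addrACA.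
Qed.
Canonical pi_frac_add_morph (R : cancelSemiring1Type) :=
  PiMorph2 (@pi_frac_add R).

Lemma pi_frac_opp (R : cancelSemiring1Type) :
  {morph \pi_(frac R) : x / frac_opp_pair x >-> frac_opp x}.
Proof.
move=> x; unlock frac_opp; apply/fracP => /=.
by rewrite addrC -frac_repr addrC.
Qed.
Canonical pi_frac_opp_morph (R : cancelSemiring1Type) :=
  PiMorph1 (@pi_frac_opp R).

Lemma oplus_addr (R : semiring1Type) (x y z : R) :
  (x \oplus y) + z = (x + z) \oplus (y + z).
Proof. by rewrite addrC addr_oplusr !(addrC z). Qed.

Lemma pi_frac_oplus (R : cancelSemiring1Type) :
  {morph \pi_(frac R) : x y / frac_oplus_pair x y >-> frac_oplus x y}.
Proof.
move=> x y; unlock frac_oplus; apply/fracP => /=.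
rewrite !oplus_addr; congr (_ \oplus _).
  rewrite addrACA frac_repr [y.2 + _]addrC addrACA.
  by rewrite -!addrA; congr (_ + _); rewrite addrC -addrA.
rewrite [(repr _).2 + (repr _).2]addrC addrACA frac_repr.
by rewrite [x.2 + y.2]addrC [x.2 + _]addrC addrACA.
Qed.
Canonical pi_frac_oplus_morph (R : cancelSemiring1Type) :=
  PiMorph2 (@pi_frac_oplus R).

Lemma frac_addA (R : cancelSemiring1Type) : associative (@frac_add R).
Proof.
elim/quotW=> x; elim/quotW=> y; elim/quotW=> z.
by rewrite !piE /frac_add_pair /= !addrA.
Qed.

Lemma frac_addC (R : cancelSemiring1Type) : commutative (@frac_add R).
Proof.
elim/quotW=> x; elim/quotW=> y.
by rewrite !piE /frac_add_pair addrC [x.2 + _]addrC.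
Qed.

Lemma frac_add0 (R : cancelSemiring1Type) :
  left_id (\pi_(frac R) (0, 0)) (@frac_add R).
Proof. by elim/quotW=> -[a b]; rewrite !piE /frac_add_pair /= !add0r. Qed.

Lemma frac_addN (R : cancelSemiring1Type) :
  left_inverse (\pi_(frac R) (0, 0)) (@frac_opp R) (@frac_add R).
Proof.
elim/quotW=> x; rewrite !piE; apply/fracP.
by rewrite /= addr0 add0r addrC.
Qed.

HB.instance Definition _ (R : cancelSemiring1Type) :=
  GRing.isZmodule.Build (frac R) (@frac_addA R) (@frac_addC R) (@frac_add0 R)
    (@frac_addN R).

Lemma frac_oplusA (R : cancelSemiring1Type) : associative (@frac_oplus R).
Proof.
elim/quotW=> x; elim/quotW=> y; elim/quotW=> z.
rewrite !piE /frac_oplus_pair /=; congr (\pi_(frac R) (_, _)); last by rewrite addrA.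
rewrite !oplus_addr oplusA; congr (_ \oplus _ \oplus _).
- by rewrite addrA.
- by rewrite addrAC.
- by rewrite -addrA [y.2 + _]addrC.
Qed.

Lemma frac_oplusC (R : cancelSemiring1Type) : commutative (@frac_oplus R).
Proof.
elim/quotW=> x; elim/quotW=> y.
by rewrite !piE /frac_oplus_pair oplusC [x.2 + _]addrC.
Qed.

Lemma frac_oplusxx (R : cancelSemiring1Type) : idempotent_op (@frac_oplus R).
Proof.
elim/quotW=> x; rewrite !piE /frac_oplus_pair oplusxx; apply/fracP => /=.
by rewrite addrA.
Qed.

Lemma frac_add_oplusr (R : cancelSemiring1Type) :
  right_distributive (@GRing.add (frac R)) (@frac_oplus R).
Proof.
elim/quotW=> x; elim/quotW=> y; elim/quotW=> z.
rewrite /GRing.add /= !piE /frac_add_pair /frac_oplus_pair; apply/fracP => /=.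
rewrite [x.1 + y.1 + _]addrACA [x.1 + z.1 + _]addrACA -addr_oplusr.
move: (_ \oplus _) => s.
by rewrite (addrACA x.2 y.2) (addrAC x.1 x.2 s) !addrA.
Qed.

HB.instance Definition _ (R : cancelSemiring1Type) :=
  Nmodule_isSemiring1.Build (frac R) (@frac_oplusA R) (@frac_oplusC R)
    (@frac_oplusxx R) (@frac_add_oplusr R).

Definition to_frac (R : cancelSemiring1Type) (A : R) : frac R :=
  \pi_(frac R) (A, 0).

Notation "A %:F" := (to_frac A) : ring_scope.

Lemma frac_diffE (R : cancelSemiring1Type) (A B : R) :
  A%:F - B%:F = \pi_(frac R) (A, B).
Proof.
rewrite /to_frac /GRing.opp /GRing.add /= !piE.
by rewrite /frac_add_pair /frac_opp_pair /= addr0 add0r.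
Qed.

Lemma frac_diffP (R : cancelSemiring1Type) (u : frac R) :
  exists A B : R, u = A%:F - B%:F.
Proof. by elim/quotW: u => -[A B]; exists A, B; rewrite frac_diffE. Qed.

Lemma frac_oplusE (R : cancelSemiring1Type) (A B A' B' : R) :
  (A%:F - B%:F) \oplus (A'%:F - B'%:F) =
  ((A + B') \oplus (A' + B))%:F - (B + B')%:F.
Proof. by rewrite !frac_diffE /oplus /= !piE. Qed.

Lemma to_frac_inj (R : cancelSemiring1Type) : injective (@to_frac R).
Proof. by move=> A B /fracP /=; rewrite !addr0. Qed.

Lemma to_frac_morphism (R : cancelSemiring1Type) :
  semiring1_morphism (@to_frac R).
Proof.
split=> [//|A B|A B]; rewrite /to_frac.
  by rewrite [RHS](esym (pi_frac_add _ _)) /frac_add_pair /= addr0.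
by rewrite [RHS](esym (pi_frac_oplus _ _)) /frac_oplus_pair /= !addr0.
Qed.

(* That one may equivalently quantify universally over the representatives
   requires [sim] to be a cancellative congruence. *)
Definition frac_cong (R : cancelSemiring1Type) (sim : R -> R -> Prop)
    (u v : frac R) : Prop :=
  exists A B A' B' : R,
    [/\ u = A%:F - B%:F, v = A'%:F - B'%:F & sim (A + B') (A' + B)].

Definition restriction (R : cancelSemiring1Type)
    (sim1 : frac R -> frac R -> Prop) (A B : R) : Prop :=
  sim1 A%:F B%:F.

(* Main.v *)
(* Congruences on [frac R] and cancellative congruences on [R] carry the same
   information because a difference [A - B] may be compared after adding common
   terms: cancellativity removes the terms by which two representatives of a
   fraction differ. Part 3 is the universal property of the fractions, applied to
   the natural map on the quotient, which is injective and whose image generates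
   the target as a group. *)

Require Import Defs.
From mathcomp Require Import all_boot ssralg boolp.

Import GRing.Theory.
Local Open Scope ring_scope.
Local Open Scope quotient_scope.

(** * Congruences on the fractions and their restrictions *)

Section FracCongruence.
Context (R : cancelSemiring1Type).
Implicit Types (A B : R) (sim : R -> R -> Prop).

Lemma frac_diff_eq A B A' B' :
  A%:F - B%:F = A'%:F - B'%:F <-> A + B' = A' + B.
Proof. by rewrite !frac_diffE; apply: fracP. Qed.

Lemma frac_diff0 A : A%:F - (0 : R)%:F = A%:F.
Proof. by rewrite frac_diffE. Qed.

Lemma to_fracD A B : (A + B)%:F = A%:F + B%:F.
Proof. by have [_ FD _] := to_frac_morphism R; apply: FD. Qed.

Lemma frac_diffD A B A' B' :
  (A%:F - B%:F) + (A'%:F - B'%:F) = (A + A')%:F - (B + B')%:F.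
Proof. by rewrite !to_fracD opprD addrACA. Qed.

(** Independence of representatives. If [C - D] and [C' - D'] are other representatives of the two
    fractions, adding [D + D'] turns the two sides into [C + D'] and [C' + D], both translated by
    [B + B']. Cancellativity of [sim] then removes [D + D']. *)
Lemma frac_congP sim : cancel_congruence sim -> forall A B A' B',
  frac_cong sim (A%:F - B%:F) (A'%:F - B'%:F) <-> sim (A + B') (A' + B).
Proof.
move=> h A B A' B'; split=> [[C [D [C' [D' []]]]]|s]; last by exists A, B, A', B'.
move=> /frac_diff_eq AD /frac_diff_eq AD' s.
apply: (cancel_congP h (X := D + D')).
have -> : D + D' + (A + B') = C + D' + (B + B').
  by rewrite addrACA [D + A]addrC AD addrACA.
have -> : D + D' + (A' + B) = C' + D + (B + B').
  by rewrite [D + D']addrC addrACA [D' + A']addrC AD' addrACA [B' + B]addrC.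
exact: (cong_add h) s.
Qed.

Lemma frac_cong_equiv sim :
  cancel_congruence sim -> RelationClasses.Equivalence (frac_cong sim).
Proof.
move=> h; have [[sr ss st] sD _] := cancel_cong h; split.
- move=> u; have [A [B ->]] := frac_diffP u; apply/frac_congP => //; exact: sr.
- move=> u v; have [A [B ->]] := frac_diffP u; have [C [D ->]] := frac_diffP v.
  by move=> /(frac_congP _ h) s; apply/(frac_congP _ h)/ss.
- move=> u v w; have [A [B ->]] := frac_diffP u.
  have [C [D ->]] := frac_diffP v; have [A' [B' ->]] := frac_diffP w.
  move=> /(frac_congP _ h) s1 /(frac_congP _ h) s2; apply/(frac_congP _ h).
  (* Transitivity needs cancellation: after adding the middle denominator [D], the chain passes
     through [C + B + B']. *)
  apply: (cancel_congP h (X := D)).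
  rewrite addrA [D + A]addrC addrA [D + A']addrC.
  apply: st (sD _ _ B' s1) _.
  by rewrite addrAC; apply: sD.
Qed.

Lemma frac_cong_semifield sim :
  cancel_congruence sim -> semifield_congruence (frac_cong sim).
Proof.
move=> h; have [[_ ss _] sD sO] := cancel_cong h; split; first split.
- exact: frac_cong_equiv.
- move=> u v w; have [A [B ->]] := frac_diffP u.
  have [A' [B' ->]] := frac_diffP v; have [C [D ->]] := frac_diffP w.
  move=> /(frac_congP _ h) s; rewrite !frac_diffD; apply/(frac_congP _ h).
  by rewrite addrACA [X in sim _ X]addrACA; apply: sD.
- move=> u v w; have [A [B ->]] := frac_diffP u.
  have [A' [B' ->]] := frac_diffP v; have [C [D ->]] := frac_diffP w.
  move=> /(frac_congP _ h) s; rewrite !frac_oplusE; apply/(frac_congP _ h).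
  (* After cross-addition the second summands coincide, and the first ones are [A + B'] and
     [A' + B], both translated by [D + D]. *)
  rewrite !oplus_addr [A + D + _]addrACA [A' + D + _]addrACA [C + B' + _]addrACA.
  by apply: sO; apply: sD.
- move=> u v; have [A [B ->]] := frac_diffP u.
  have [A' [B' ->]] := frac_diffP v.
  move=> /(frac_congP _ h) s; rewrite !opprB; apply/(frac_congP _ h).
  by rewrite addrC [B' + A]addrC; apply: ss.
Qed.

Lemma frac_cong_to_frac sim : cancel_congruence sim -> forall A B,
  sim A B <-> frac_cong sim A%:F B%:F.
Proof.
move=> h A B; rewrite -(frac_diff0 A) -(frac_diff0 B).
by rewrite (propext (frac_congP _ h _ _ _ _)) !addr0.
Qed.

Lemma frac_cong0P sim : cancel_congruence sim -> forall u : frac R,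
  frac_cong sim 0 u <-> exists A B, u = A%:F - B%:F /\ sim A B.
Proof.
move=> h u; have [[_ ss _] _ _] := cancel_cong h.
have F0 : 0 = (0 : R)%:F - (0 : R)%:F by rewrite subrr.
split=> [|[A [B [-> s]]]].
  have [A [B ->]] := frac_diffP u; rewrite {1}F0.
  by move=> /(frac_congP _ h); rewrite add0r addr0 => /ss s; exists A, B.
by rewrite F0; apply/(frac_congP _ h); rewrite add0r addr0; apply: ss.
Qed.

Lemma restriction_cancel (sim1 : frac R -> frac R -> Prop) :
  semifield_congruence sim1 -> cancel_congruence (restriction sim1).
Proof.
have [_ _ FO] := to_frac_morphism R.
move=> h; have [[sr ss st] sD sO] := semifield_cong h; split; first split.
- split=> [A|A B|A B C]; [exact: sr|exact: ss|exact: st].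
- by move=> A B C s; rewrite /restriction !to_fracD; apply: sD.
- by move=> A B C s; rewrite /restriction !FO; apply: sO.
(* Cancellation is automatic in a group: translate by the opposite of [A%:F]. *)
- move=> A B C; rewrite /restriction !to_fracD => /(sD _ _ (- A%:F)).
  by rewrite ![A%:F + _]addrC !addrK.
Qed.

Lemma frac_cong_restriction (sim1 : frac R -> frac R -> Prop) :
  semifield_congruence sim1 -> frac_cong (restriction sim1) = sim1.
Proof.
move=> h; apply/funext => u; apply/funext => v; apply/propext.
have sD (x y z : frac R) : sim1 x y -> sim1 (x + z) (y + z) by apply: (cong_add h).
have [A [B ->]] := frac_diffP u; have [A' [B' ->]] := frac_diffP v.
rewrite (propext (frac_congP _ (restriction_cancel _ h) _ _ _ _)) /restriction.
(* Translation by the sum of both denominators, or by its opposite, passes between differences and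
   elements of [R]. *)
rewrite !to_fracD; split=> [/(sD _ _ (- B%:F - B'%:F))|/(sD _ _ (B%:F + B'%:F))].
  by rewrite addrACA subrr addr0 [- B%:F - _]addrC addrACA subrr addr0.
by rewrite addrA subrK [B%:F + _]addrC addrA subrK.
Qed.

End FracCongruence.

(** * Universal property of the semi-field of fractions *)

Section FracLift.
Context (R : cancelSemiring1Type) (F : semifield1Type) (f : R -> F).
Hypothesis f_morph : semiring1_morphism f.

(** The value is computed on a chosen representative; [frac_lift_diff] shows that any other one
    gives the same result. *)
Definition frac_lift (u : frac R) : F := f (repr u).1 - f (repr u).2.

Lemma frac_lift_diff A B : frac_lift (A%:F - B%:F) = f A - f B.
Proof.
have [_ fD _] := f_morph.
have /= e := frac_repr (A, B).
rewrite frac_diffE /frac_lift; apply/eqP.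
by rewrite subr_eq addrAC eq_sym subr_eq -!fD e.
Qed.

Lemma frac_lift_to_frac A : frac_lift A%:F = f A.
Proof.
have [f0 _ _] := f_morph.
by rewrite -(frac_diff0 _ A) frac_lift_diff f0 subr0.
Qed.

Lemma frac_lift_morphism : semiring1_morphism frac_lift.
Proof.
have [f0 fD fO] := f_morph; have [F0 _ _] := to_frac_morphism R; split.
- by rewrite -F0 frac_lift_to_frac f0.
- move=> u v; have [A [B ->]] := frac_diffP u; have [C [D ->]] := frac_diffP v.
  by rewrite frac_diffD !frac_lift_diff !fD opprD addrACA.
- move=> u v; have [A [B ->]] := frac_diffP u; have [C [D ->]] := frac_diffP v.
  rewrite frac_oplusE !frac_lift_diff fO !fD oplus_addr.
  (* Subtracting the common denominator distributes over [oplus]; in each summand it cancels the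
     term brought in by cross-addition. *)
  congr (_ \oplus _); rewrite opprD; first by rewrite addrACA subrr addr0.
  by rewrite [- f B - _]addrC addrACA subrr addr0.
Qed.

(** In the group [F], equal differences of images amount to [f (A + D) = f (C + B)], to which
    injectivity of [f] applies. *)
Lemma frac_lift_inj : injective f -> injective frac_lift.
Proof.
have [_ fD _] := f_morph.
move=> f_inj u v; have [A [B ->]] := frac_diffP u.
have [C [D ->]] := frac_diffP v; rewrite !frac_lift_diff => /eqP.
rewrite subr_eq addrAC eq_sym subr_eq -!fD => /eqP /f_inj e.
exact/frac_diff_eq.
Qed.

End FracLift.

(** Choice turns surjectivity into a right inverse, which injectivity makes two-sided. *)
Lemma inj_surj_bij (T U : Type) (f : T -> U) :
  injective f -> (forall y, exists x, f x = y) -> bijective f.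
Proof.
move=> f_inj /choice[g fK]; exists g => // x; exact/f_inj/fK.
Qed.

(** * The natural map between the quotients *)

Section QuotientFractions.
Context (R : cancelSemiring1Type) (sim : R -> R -> Prop).
Context (h : cancel_congruence sim).
Context (hF : semifield_congruence (frac_cong sim)).

Definition quot_to_frac (x : cancel_quot h) : semifield_quot hF :=
  \pi_(semifield_quot hF) (repr x)%:F.

(** Well-definedness is one direction of [frac_cong_to_frac]; the other direction gives injectivity
    in [quot_to_frac_inj]. *)
Lemma quot_to_fracE A :
  quot_to_frac (\pi_(cancel_quot h) A) = \pi_(semifield_quot hF) A%:F.
Proof.
rewrite /quot_to_frac; apply/(Defs.quotP (semifield_cong hF))/(frac_cong_to_frac _ _ h).
by have [[_ ss _] _ _] := cancel_cong h; apply/ss/(cong_repr (cancel_cong h)).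
Qed.

Lemma quot_to_frac_inj : injective quot_to_frac.
Proof.
elim/quotW=> A; elim/quotW=> B; rewrite !quot_to_fracE.
move=> /(Defs.quotP (semifield_cong hF)) /(frac_cong_to_frac _ _ h) s.
exact/(Defs.quotP (cancel_cong h)).
Qed.

Lemma quot_to_frac_morphism : semiring1_morphism quot_to_frac.
Proof.
have [F0 FD FO] := to_frac_morphism R; split.
- exact: quot_to_fracE.
- elim/quotW=> A; elim/quotW=> B.
  rewrite -[X in quot_to_frac X](pi_quot_add (cancel_cong h)) !quot_to_fracE FD.
  exact: (pi_quot_add (semifield_cong hF)).
- elim/quotW=> A; elim/quotW=> B.
  rewrite -[X in quot_to_frac X](pi_quot_oplus (cancel_cong h)) !quot_to_fracE FO.
  exact: (pi_quot_oplus (semifield_cong hF)).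
Qed.

(** The class of [A - B] is the difference of the classes of [A] and [B], both in the image of
    [quot_to_frac]. *)
Lemma frac_lift_quot_surj (y : semifield_quot hF) :
  exists x, frac_lift _ _ quot_to_frac x = y.
Proof.
elim/quotW: y => u; have [A [B ->]] := frac_diffP u.
exists ((\pi_(cancel_quot h) A)%:F - (\pi_(cancel_quot h) B)%:F).
rewrite (frac_lift_diff _ _ _ quot_to_frac_morphism) !quot_to_fracE.
rewrite [RHS](pi_quot_add (semifield_cong hF)); congr (_ + _).
exact/esym/pi_semifield_quot_opp.
Qed.

End QuotientFractions.

Theorem proposition8 (R : cancelSemiring1Type) :
  (* 1 *)
  (forall sim : R -> R -> Prop, cancel_congruence sim ->
    [/\ forall A B A' B' : R,
          frac_cong sim (A%:F - B%:F) (A'%:F - B'%:F) <-> sim (A + B') (A' + B),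
        semifield_congruence (frac_cong sim),
        forall u : frac R, frac_cong sim 0 u <->
          exists A B : R, u = A%:F - B%:F /\ sim A B
      & forall A B : R, sim A B <-> frac_cong sim A%:F B%:F])
  /\
  (* 2 *)
  (forall sim1 : frac R -> frac R -> Prop, semifield_congruence sim1 ->
    unique (fun sim : R -> R -> Prop =>
              cancel_congruence sim /\ frac_cong sim = sim1)
           (restriction sim1))
  /\
  (* 3 *)
  (forall (sim : R -> R -> Prop) (h : cancel_congruence sim)
      (hF : semifield_congruence (frac_cong sim)),
    exists f : cancel_quot h -> semifield_quot hF,
      [/\ forall A : R, f (\pi_(cancel_quot h) A) = \pi_(semifield_quot hF) A%:F,
          injective f,
          semiring1_morphism f
        & exists phi : frac (cancel_quot h) -> semifield_quot hF,
            [/\ bijective phi,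
                semiring1_morphism phi
              & forall x : cancel_quot h, phi x%:F = f x]]).
Proof.
split; [|split].
- move=> sim h; split.
  + exact: frac_congP.
  + exact: frac_cong_semifield.
  + exact: frac_cong0P.
  + exact: frac_cong_to_frac.
- move=> sim1 h1; split.
    by split; [exact: restriction_cancel|exact: frac_cong_restriction].
  (* Uniqueness: a cancellative congruence is recovered from the one it induces on fractions by
     restricting the latter. *)
  move=> sim [h <-]; apply/funext => A; apply/funext => B; apply/propext.
  exact: iff_sym (frac_cong_to_frac _ _ h A B).
- move=> sim h hF; have fm := quot_to_frac_morphism _ _ h hF.
  exists (quot_to_frac _ _ h hF); split=> //.
  + exact: quot_to_fracE.
  + exact: quot_to_frac_inj.
  (* The identification is the extension of the natural map to differences of classes. *)
  + exists (frac_lift _ _ (quot_to_frac _ _ h hF)); split.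
    * apply: inj_surj_bij; last exact: frac_lift_quot_surj.
      exact/(frac_lift_inj _ _ _ fm)/quot_to_frac_inj.
    * exact: (frac_lift_morphism _ _ _ fm).
    * exact: (frac_lift_to_frac _ _ _ fm).
Qed.
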